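(* Let $\mathsf{G}=(N,B,w)$ be a weighted digraph with node set $N=\{1,\dots,n\}$ and constant branch weights $w_{ij}>0$ for $(j,i)\in B$. Consider the following three network protocols ($i\in N$), with initial conditions restricted to $\mathbb{R}^n_{>0}$: (1) polynomial protocol: $\displaystyle \dot{x}_i=-\prod_{j\in N_i^-}x_i^{w_{ji}}+\prod_{j\in N_i^+}x_j^{w_{ij}}$; (2) entropic protocol: $\displaystyle \dot{x}_i=-\sum_{j\in N_i^+}w_{ij}\,x_i\ln\frac{x_i}{x_j}$; (3) scaling-invariant protocol: $\displaystyle \dot{x}_i=\sum_{j\in N_i^+}w_{ij}(\ln x_j-\ln x_i)$. If the underlying digraph $\mathsf{G}$ is strongly connected, then protocols (2) and (3) converge exponentially fast to a consensus configuration. If in addition the weighting is balanced, then protocol (1) converges exponentially fast to a consensus state. In all three cases the equilibrium $\bar{x}\boldsymbol{1}$ has agreement value satisfying $$\min_{i\in N}x_i(0)<\bar{x}<\max_{i\in N}x_i(0).$$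
   Context: A weighted digraph $\mathsf{G}=(N,B,w)$ has nodes $N=\{1,\dots,n\}$, a set of branches $B\subseteq N\times N$ whose elements are ordered pairs $(j,i)$ indicating a branch from node $j$ to node $i$, and a weighting $w:B\to\mathbb{R}_{>0}$ with $w_{ij}:=w((j,i))$. There are no self-loops, and $w_{ij}:=0$ if $(j,i)\notin B$. The weights are constant in time. The in-neighborhood of node $i$ is $N_i^+:=\{j\in N:(j,i)\in B\}$ and the out-neighborhood is $N_i^-:=\{j\in N:(i,j)\in B\}$. The graph (or its weighting) is balanced if $\sum_{j=1}^n w_{ij}=\sum_{j=1}^n w_{ji}$ for every $i\in N$. It is strongly connected if there is a directed path from every node to every other node. A consensus configuration (consensus state) is a vector $\bar{x}\boldsymbol{1}$, where $\boldsymbol{1}$ is the all-ones vector and $\bar{x}\in\mathbb{R}$ is the agreement (consensus) value. The state is $\boldsymbol{x}(t)=(x_1(t),\dots,x_n(t))$ with initial condition $\boldsymbol{x}(0)$. Exponentially fast convergence to $\bar{x}\boldsymbol{1}$ means that $\|\boldsymbol{x}(t)-\bar{x}\boldsymbol{1}\|\le C e^{-\gamma t}$ for all $t\ge 0$, for some constants $C,\gamma>0$ (possibly depending on the initial condition).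
   Formalization: The strict bounds min x_i(0) < x̄ < max x_i(0) are asserted only when x(0) is not already a consensus state (there min = max, so they fail, e.g. x(0)=(1,1)); for every x(0) the weak bounds and exponential convergence are asserted. *)

(* Defs.v *)
From HB Require Import structures.
From mathcomp Require Import all_boot all_order all_algebra.
From mathcomp Require Import all_classical all_reals all_analysis.

Set Implicit Arguments.
Unset Strict Implicit.
Unset Printing Implicit Defensive.

Import Order.TTheory GRing.Theory Num.Theory.
Import numFieldNormedType.Exports.

Local Open Scope classical_set_scope.
Local Open Scope ring_scope.

(* The pair (j, i) in [branch G] is a branch from node j to node i, and its
   weight is [weight G i j] (head first, as in w_ij). *)
Record wdigraph (R : realType) (n : nat) := WDigraph {
  branch : {set 'I_n * 'I_n};
  weight : 'I_n -> 'I_n -> R;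
  branch_irr : forall i, (i, i) \notin branch;
  weight_gt0 : forall i j, (j, i) \in branch -> 0 < weight i j;
  weight_eq0 : forall i j, (j, i) \notin branch -> weight i j = 0 }.

Section Graph.
Context (R : realType) (n : nat) (G : wdigraph R n).
Implicit Types (i j : 'I_n) (x : 'rV[R]_n).

Definition in_nbhd i : {set 'I_n} := [set j | (j, i) \in branch G]%SET.

Definition out_nbhd i : {set 'I_n} := [set j | (i, j) \in branch G]%SET.

Definition balanced : Prop :=
  forall i, \sum_j weight G i j = \sum_j weight G j i.

Definition strongly_connected : Prop :=
  forall i j, connect (fun a b => (a, b) \in branch G) i j.

Definition polynomial_protocol x i : R :=
  - (\prod_(j in out_nbhd i) x 0 i `^ weight G j i)
  + \prod_(j in in_nbhd i) x 0 j `^ weight G i j.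

Definition entropic_protocol x i : R :=
  - \sum_(j in in_nbhd i) weight G i j * x 0 i * ln (x 0 i / x 0 j).

Definition scaling_invariant_protocol x i : R :=
  \sum_(j in in_nbhd i) weight G i j * (ln (x 0 j) - ln (x 0 i)).

End Graph.

(* x solves dx_i/dt = F_i(x) on [0, +oo[ from a positive initial state. The
   values of x at negative times are irrelevant, so at t = 0 only continuity
   from the right is required. Positivity is not required for t > 0: it is a
   consequence for the protocols above. *)
Definition solution_from_positive (R : realType) (n : nat)
    (F : 'rV[R]_n -> 'I_n -> R) (x : R -> 'rV[R]_n) : Prop :=
  [/\ forall i, 0 < x 0 0 i,
      forall i, {within `[0, +oo[, continuous (fun t : R => x t 0 i)} &
      forall (t : R) i, 0 < t -> is_derive t 1 (fun s => x s 0 i) (F (x t) i)].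

Definition eucl_norm (R : realType) (n : nat) (v : 'rV[R]_n) : R :=
  Num.sqrt (\sum_i v 0 i ^+ 2).

Definition exp_converges_to_consensus (R : realType) (n : nat)
    (x : R -> 'rV[R]_n) (xbar : R) : Prop :=
  exists C gamma : R, [/\ 0 < C, 0 < gamma &
    forall t, 0 <= t ->
      eucl_norm (x t - const_mx xbar) <= C * expR (- gamma * t)].

Definition consensus (R : realType) (n : nat) (v : 'rV[R]_n) : Prop :=
  exists c : R, v = const_mx c.

Definition vmin (R : realType) (n : nat) (v : 'rV[R]_n.+1) : R :=
  \big[Num.min/v 0 ord0]_i v 0 i.

Definition vmax (R : realType) (n : nat) (v : 'rV[R]_n.+1) : R :=
  \big[Num.max/v 0 ord0]_i v 0 i.

(* The strict bounds on the agreement value are impossible from a consensus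
   state, where the minimum and the maximum coincide; from such a state the
   weak bounds determine the agreement value. *)
Definition reaches_consensus (R : realType) (n : nat)
    (x : R -> 'rV[R]_n.+1) : Prop :=
  exists xbar : R, [/\ exp_converges_to_consensus x xbar,
    vmin (x 0) <= xbar <= vmax (x 0) &
    ~ consensus (x 0) -> vmin (x 0) < xbar < vmax (x 0)].

(* Main.v *)
(* On a box [m, M]^n with m > 0, each protocol has the form
   F_i(x) = h_i(x) * sum_j w_ij (ln x_j - ln x_i) with h_i between two positive
   constants; for the polynomial protocol balance gives
   F_i(x) = exp(sum_j w_ij ln x_j) - exp(sum_j w_ij ln x_i), and h_i is a slope
   of a secant of exp.  Hence F_i >= 0 where x_i is minimal and F_i <= 0 where it
   is maximal, so solutions stay in the box of their initial state.  There the
   slopes of the secants of ln are bounded as well, and x solves a time-varying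
   linear system x_i' = sum_j c_ij(t) (x_j - x_i) with c_ij(t) comparable to w_ij.
   For such a system the excess of any node over the minimum is passed along
   every edge up to a constant factor in unit time.  By strong connectivity, after
   #nodes units of time the minimum has grown by a fixed fraction of the spread
   max - min; symmetrically the maximum has decreased.  So the spread decays
   exponentially and the limit is strictly inside the initial range. *)

Require Import Defs.
From mathcomp Require Import all_boot all_order all_algebra.
From mathcomp Require Import all_classical all_reals all_analysis.
From mathcomp Require Import ring lra.

Set Implicit Arguments.
Unset Strict Implicit.
Unset Printing Implicit Defensive.

Import Order.TTheory GRing.Theory Num.Theory.
Import numFieldNormedType.Exports.

Local Open Scope classical_set_scope.
Local Open Scope ring_scope.

(** * One-variable calculus: first zeros, a barrier principle, a Gronwall inequality *)

Lemma derive_le0_left (R : realType) (f : R -> R) (a t d : R) :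
  a < t -> is_derive t 1 f d -> (forall u, a < u < t -> f t <= f u) -> d <= 0.
Proof.
move=> at_ dfd fmin.
have df : derivable f t 1 by [].
rewrite -(@derive_val _ _ _ _ _ _ _ dfd) ['D_1 f t]cvg_at_leftE //.
apply: limr_le.
  rewrite -(cvg_at_leftE (fun h => h^-1 *: ((f \o shift t) _ - f t))) //.
  apply: cvg_trans df; apply: cvg_app.
  move=> A [e egt0 Ae]; exists e => // x xe xgt0; apply: Ae => //.
  exact/ltr0_neq0.
near=> h; apply: mulr_le0_ge0.
  by rewrite invr_le0; apply: ltW; near: h; exists 1 => /=.
rewrite subr_ge0 [_%:A]mulr1; apply: fmin; near: h.
exists (t - a); first by rewrite /= subr_gt0.
move=> h; rewrite /= distrC subr0.
move=> /ltr_normlP []; rewrite ltrBrDl ltrBlDl => h1 h2 h0.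
by rewrite h1 gtrDr.
Unshelve. all: by end_near. Qed.

(** [c] is the least point of the compact set where [f <= 0]; the intermediate value theorem on
    [[a, c]] then forces [f c = 0]. *)
Lemma first_zero (R : realType) (f : R -> R) (a b : R) :
  a <= b -> {within `[a, b], continuous f} -> 0 < f a -> f b <= 0 ->
  exists c, [/\ a < c, c <= b, f c = 0 & forall t, a <= t -> t < c -> 0 < f t].
Proof.
move=> ab cf fa fb.
have cZ : compact (`[a, b] `&` [set t | f t <= 0]).
  have : closed (f @^-1` [set u | u <= 0] : set (subspace `[a, b])).
    by apply: preimage_closed; [move=> x _; exact: cf|exact: closed_le].
  case/(closed_subspaceP _ _).1 => V cV VE.
  have -> : `[a, b] `&` [set t | f t <= 0] = `[a, b] `&` V.
    by rewrite setIC [RHS]setIC VE.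
  by apply: compact_closedI => //; exact: segment_compact.
have Z0 : (`[a, b] `&` [set t | f t <= 0]) !=set0.
  by exists b; split => //=; rewrite in_itv /= ab lexx.
have [|c] := compact_EVT_min (f := id) Z0 cZ.
  by apply: continuous_subspaceT => x; exact: cvg_id.
rewrite inE /= in_itv /= => -[/andP[ac cb] fc] cmin.
have fpos t : a <= t -> t < c -> 0 < f t.
  move=> at_ tc; rewrite ltNge; apply/negP => ft.
  have := cmin t; rewrite inE /= in_itv /= at_ ft (le_trans (ltW tc) cb).
  by move=> /(_ (conj isT isT)); rewrite leNgt tc.
have {}ac : a < c.
  rewrite lt_neqAle ac andbT; apply/eqP => ac'.
  by move: fc; rewrite -ac' leNgt fa.
exists c; split => //.
have [||d] := @IVT R f a c 0 (ltW ac).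
- apply: continuous_subspaceW cf => t /=; rewrite !in_itv /= => /andP[-> tc].
  exact: le_trans tc cb.
- by rewrite ge_min fc orbT le_max ltW.
rewrite in_itv /= => /andP[ad dc] fd.
move: dc; rewrite le_eqVlt => /orP[/eqP <- //|dc].
by move: (fpos d ad dc); rewrite fd ltxx.
Qed.

Lemma continuous_bigmin (R : realType) (T : topologicalType) (I : Type)
    (r : seq I) (f0 : T -> R) (f : I -> T -> R) :
  continuous f0 -> (forall i, continuous (f i)) ->
  continuous (fun t => \big[Num.min/f0 t]_(i <- r) f i t).
Proof.
move=> cf0 cf; elim: r => [|i r IHr] t.
  by under eq_fun do rewrite big_nil; exact: cf0.
under eq_fun do rewrite big_cons.
exact: (@continuous_min R T (f i) _ t (cf i t) (IHr t)).
Qed.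

(* Below the level [c] nothing is known about the derivatives: for the logarithmic
   protocols, [c = 0].  The slope [-e] of the moving barrier makes the sign
   condition strict at the first time the minimum meets it. *)
Lemma min_barrier (R : realType) (I : finType) (y dy : I -> R -> R)
    (a b c m : R) :
  a <= b -> c < m ->
  (forall i, {within `[a, b], continuous (y i)}) ->
  (forall t i, a < t -> t <= b -> is_derive t 1 (y i) (dy i t)) ->
  (forall t i, a < t -> t <= b -> c < y i t -> (forall j, y i t <= y j t) ->
    0 <= dy i t) ->
  (forall i, m <= y i a) -> forall i, m <= y i b.
Proof.
move=> ab cm cy ddy dyge0 ya i; rewrite leNgt; apply/negP => yib.
(* The barrier [m - e * (1 + (t - a))] starts strictly below [m], and [e] is so small that at [b] it
   still exceeds both [y i b] and [c]. *)
pose e := Num.min (m - y i b) (m - c) / (2 * (1 + (b - a))).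
have ba0 : 0 <= b - a by rewrite subr_ge0.
have den0 : 0 < 2 * (1 + (b - a)) by lra.
have num0 : 0 < Num.min (m - y i b) (m - c) by rewrite lt_min !subr_gt0 yib.
have e0 : 0 < e by rewrite divr_gt0.
have eE : 2 * (e * (1 + (b - a))) = Num.min (m - y i b) (m - c).
  by rewrite /e; field; lra.
have e1 : e * (1 + (b - a)) < m - y i b.
  have : Num.min (m - y i b) (m - c) <= m - y i b by rewrite ge_min lexx.
  by lra.
have e2 : e * (1 + (b - a)) < m - c.
  have : Num.min (m - y i b) (m - c) <= m - c by rewrite ge_min lexx orbT.
  by lra.
pose phi t := \big[Num.min/y i t]_j y j t.
have phi_le t j : phi t <= y j t by exact: bigmin_le.
have phi_att t : exists j, phi t = y j t.
  have [k _ Hk] := arg_minP (fun j => y j t) (isT : xpredT i).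
  exists k; apply/eqP; rewrite eq_le phi_le /=.
  by rewrite le_bigmin // => *; exact: Hk.
pose v t := phi t + (e * (1 + (t - a)) - m).
have [|||t [at_ tb vt vpos]] := @first_zero R v a b ab.
- have cphi : {within `[a, b], continuous phi}.
    exact: (@continuous_bigmin R (subspace `[a, b]) I _ (y i) y (cy i) cy).
  have caff : {within `[a, b], continuous (fun t => e * (1 + (t - a)) - m)}.
    apply: continuous_subspaceT => u.
    apply: cvgB; last exact: cvg_cst.
    apply: cvgMr; apply: cvgD; first exact: cvg_cst.
    by apply: cvgB; [exact: cvg_id|exact: cvg_cst].
  by move=> t; exact: (cvgD (cphi t) (caff t)).
- have [j E] := phi_att a; have := ya j; rewrite /v E subrr; lra.
- have := phi_le b i; rewrite /v; lra.
have [j E] := phi_att t.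
have dj := ddy t j at_ tb.
(* Before [t] all nodes lie above the barrier, which [j] meets at [t]; so [y j u + e * u] is least
   at [u = t], whence [dy j t <= - e]. *)
have dv : is_derive t 1 (fun u => y j u + e * u) (dy j t + e).
  apply: is_deriveD.
  have := @is_deriveZ R R R (@id R) e t 1 1 (is_derive_id t 1).
  by rewrite /GRing.scale /= mulr1.
have : dy j t + e <= 0.
  apply: (derive_le0_left at_ dv) => u /andP[au ut].
  have := vpos u (ltW au) ut; have := phi_le u j; move: vt; rewrite /v E; lra.
have : 0 <= dy j t.
  apply: dyge0 => //; last by move=> k; rewrite -E.
  rewrite -E; move: vt; rewrite /v.
  have : e * (1 + (t - a)) <= e * (1 + (b - a)).
    by rewrite ler_pM2l //; lra.
  by lra.
lra.
Qed.

(** With the integrating factor [expR (L * t)], the function [(f t - c) * expR (L * t)] has a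
    nonnegative derivative, whatever the sign of [L]. *)
Lemma gronwall_ge (R : realType) (f df : R -> R) (L c a b : R) :
  a <= b -> {within `[a, b], continuous f} ->
  (forall t, a < t < b -> is_derive t 1 f (df t)) ->
  (forall t, a < t < b -> L * (c - f t) <= df t) ->
  c + (f a - c) * expR (- L * (b - a)) <= f b.
Proof.
rewrite le_eqVlt => /predU1P[<- _ _ _|ab cf ddf dfge].
  by rewrite subrr mulr0 expR0 mulr1 addrC subrK.
pose E t := expR (L * t).
have dE (t : R) : is_derive t 1 E (E t * L).
  apply: (@is_derive1_comp R (@expR R) (fun t => L * t)).
  have := @is_deriveZ R R R (@id R) L t 1 1 (is_derive_id t 1).
  by rewrite /GRing.scale /= mulr1.
pose h t := (f t - c) * E t.
have dh (t : R) : t \in `]a, b[ -> is_derive t 1 h (E t * (df t - L * (c - f t))).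
  rewrite in_itv /= => tab; have := ddf t tab; have := dE t => dEt dft.
  have dfc : is_derive t 1 (fun u => f u - c) (df t).
    apply: (is_derive_eq (is_deriveB dft (is_derive_cst c t 1))).
    by rewrite subr0.
  apply: (is_derive_eq (is_deriveM dfc dEt)).
  by rewrite /GRing.scale /=; ring.
have ch : {within `[a, b], continuous h}.
  have cE : {within `[a, b], continuous E}.
    apply: continuous_subspaceT => t; apply: differentiable_continuous.
    by apply/derivable1_diffP; have [] := dE t.
  move=> t; apply: (cvgM _ (cE t)).
  by apply: cvgB; [exact: (cf t)|exact: cvg_cst].
have [t tab hE] := MVT ab dh ch.
have {hE} : 0 <= h b - h a.
  rewrite hE mulr_ge0 ?subr_ge0 ?(ltW ab)// mulr_ge0 ?expR_ge0 // subr_ge0.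
  by apply: dfge; move: tab; rewrite in_itv.
rewrite subr_ge0 /h => hab.
rewrite -lerBrDl -(ler_pM2r (expR_gt0 (L * b))).
apply: le_trans hab; rewrite -mulrA -expRD /E.
by have -> : - L * (b - a) + L * b = L * a by ring.
Qed.

(** * Time-varying linear averaging systems *)

(** The coefficients [c] may depend on the trajectory [y], which lets nonlinear protocols fit in. *)
Definition averaging (R : realType) (I : finType) (w : I -> I -> R) (c0 c1 : R)
    (y : I -> R -> R) :=
  (forall i, {within `[0, +oo[, continuous (y i)}) /\
  exists c : R -> I -> I -> R,
    (forall (t : R) i j, 0 < t -> c0 * w i j <= c t i j <= c1 * w i j) /\
    (forall (t : R) i, 0 < t ->
      is_derive t 1 (y i) (\sum_j c t i j * (y j t - y i t))).

Section Averaging.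
Context (R : realType) (I : finType) (w : I -> I -> R) (c0 c1 : R).
Context (w_ge0 : forall i j, 0 <= w i j) (c0_gt0 : 0 < c0) (c1_ge0 : 0 <= c1).
Implicit Types (y : I -> R -> R) (i j k : I).

(** Since [p] may be negative, upper bounds follow from lower bounds by reflection. *)
Lemma averaging_affine y (p q : R) :
  averaging w c0 c1 y -> averaging w c0 c1 (fun i t => p * y i t + q).
Proof.
move=> [cy [c [cb dy]]]; split.
  move=> i t; apply: cvgD; last exact: cvg_cst.
  by apply: cvgMr; exact: (cy i t).
exists c; split=> // t i t0.
have dyi := dy t i t0.
apply: (is_derive_eq (is_deriveD (is_deriveZ p dyi) (is_derive_cst q t 1))).
rewrite addr0 scaler_sumr.
by apply: eq_bigr => j _; rewrite /GRing.scale /=; ring.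
Qed.

Lemma averaging_continuous y a b i : averaging w c0 c1 y -> 0 <= a ->
  {within `[a, b], continuous (y i)}.
Proof.
move=> [cy _] a0; apply: continuous_subspaceW (cy i) => t /=.
by rewrite !in_itv /= => /andP[/(le_trans a0) ->].
Qed.

(** At a minimal node all terms of the sum are nonnegative. This holds at every level, so [m - 1] is
    an arbitrary level for [min_barrier]. *)
Lemma averaging_ge y (m s t : R) : averaging w c0 c1 y -> 0 <= s -> s <= t ->
  (forall i, m <= y i s) -> forall i, m <= y i t.
Proof.
move=> ay s0 st ys; have [_ [c [cb dy]]] := ay.
apply: (@min_barrier R I y (fun i t => \sum_j c t i j * (y j t - y i t))
  s t (m - 1)) => //.
- by rewrite gtrBl.
- by move=> i; exact: averaging_continuous.
- by move=> u i su _; apply: dy; exact: le_lt_trans su.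
move=> u i su _ _ ymin; apply: sumr_ge0 => j _.
rewrite mulr_ge0 ?subr_ge0 //.
have /andP[+ _] := cb u i j (le_lt_trans s0 su).
by apply: le_trans; rewrite mulr_ge0 // ltW.
Qed.

(** Bounds the total coefficient [\sum_j c t i j] at any node; the [+ 1] keeps it positive when all
    weights vanish. *)
Let rate := c1 * (\sum_i \sum_j w i j) + 1.

Lemma averaging_deriv_ge (c : I -> R) (z : I -> R) k i :
  (forall j, c0 * w i j <= c j <= c1 * w i j) -> (forall j, 0 <= z j) ->
  c0 * w i k * z k - rate * z i <= \sum_j c j * (z j - z i).
Proof.
move=> cb z0.
under eq_bigr do rewrite mulrBr.
rewrite sumrB -mulr_suml lerB //.
  rewrite (bigD1 k) //= -[leLHS]addr0 lerD //.
    by rewrite ler_wpM2r //; have /andP[] := cb k.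
  apply: sumr_ge0 => j _; rewrite mulr_ge0 //.
  by have /andP[+ _] := cb j; apply: le_trans; rewrite mulr_ge0 // ltW.
rewrite ler_wpM2r //.
have S i' : 0 <= \sum_j w i' j by exact: sumr_ge0.
have le1 : \sum_j c j <= c1 * \sum_j w i j.
  by rewrite mulr_sumr ler_sum // => j _; have /andP[] := cb j.
have le2 : c1 * \sum_j w i j <= rate.
  rewrite /rate [X in _ <= c1 * X + 1](bigD1 i) //= mulrDr -addrA lerDl addr_ge0 //.
  by rewrite mulr_ge0 ?sumr_ge0.
exact: le_trans le2.
Qed.

Lemma rate_gt0 : 0 < rate.
Proof.
by rewrite ltr_wpDl // mulr_ge0 // sumr_ge0 // => i _; rewrite sumr_ge0.
Qed.

Lemma averaging_decay y k (s t : R) : averaging w c0 c1 y -> 0 <= s -> s <= t ->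
  (forall i, 0 <= y i s) -> expR (- rate * (t - s)) * y k s <= y k t.
Proof.
move=> ay s0 st ys; have [_ [c [cb dy]]] := ay.
have := @gronwall_ge R (y k) (fun t => \sum_j c t k j * (y j t - y k t))
  rate 0 s t st (@averaging_continuous y s t k ay s0).
rewrite subr0 add0r mulrC; apply=> u /andP[su _].
  by apply: dy; exact: le_lt_trans su.
rewrite sub0r mulrN -mulNr; have u0 := le_lt_trans s0 su.
have y0 := averaging_ge ay s0 (ltW su) ys.
apply: (le_trans _ (averaging_deriv_ge k (fun j => cb u k j u0) y0)).
by rewrite mulNr lerDr mulr_ge0 // mulr_ge0 // ltW.
Qed.

(** Over unit time [k] keeps at least the fraction [expR (- rate)] of its value, which feeds [i]
    through the edge; the case [i == k] is waiting. [rho] is uniform in [y] and [s]. *)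
Lemma averaging_edge : exists2 rho : R, 0 < rho < 1 &
  forall y, averaging w c0 c1 y ->
  forall s : R, 0 <= s -> (forall i, 0 <= y i s) ->
  forall k i, (i == k) || (0 < w i k) -> rho * y k s <= y i (s + 1).
Proof.
have rate0 := rate_gt0.
(* The default [1] keeps [w0] positive when there are no edges. *)
pose w0 := \big[Num.min/1]_(p : I * I | 0 < w p.1 p.2) w p.1 p.2.
have w00 : 0 < w0 by exact: lt_bigmin.
have w0_le i k : 0 < w i k -> w0 <= w i k.
  by move=> wik; exact: (@bigmin_le_cond _ R _ 1 (i, k)).
pose r := c0 * w0 * expR (- rate) / rate * (1 - expR (- rate)).
have erate : expR (- rate) < 1 by rewrite expR_lt1 oppr_lt0.
have r0 : 0 < r by rewrite !mulr_gt0 ?invr_gt0 ?expR_gt0 ?subr_gt0.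
exists (Num.min (expR (- rate)) r); first by rewrite lt_min expR_gt0 r0 gt_min erate.
move=> y ay s s0 ys k i; have s1 : s <= s + 1 by rewrite lerDl.
have [->|_ /= wik] := eqVneq i k.
  move=> _; apply: le_trans (averaging_decay k ay s0 s1 ys).
  by rewrite addrC addKr mulr1 ler_wpM2r // ge_min lexx.
apply: (@le_trans _ _ (r * y k s)).
  by rewrite ler_wpM2r // ge_min lexx orbT.
have [_ [c [cb dy]]] := ay.
(* [b] is the rest point of the comparison equation [z' = rate * (b - z)]; from [z >= 0], unit time
   yields at least [b * (1 - expR (- rate))], which is [r * y k s]. *)
pose b := c0 * w0 * expR (- rate) / rate * y k s.
have b0 : 0 <= b.
  by rewrite !mulr_ge0 ?invr_ge0 ?expR_ge0 // ltW.
have := @gronwall_ge R (y i) (fun t => \sum_j c t i j * (y j t - y i t))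
  rate b s (s + 1) s1 (@averaging_continuous y s (s + 1) i ay s0).
move=> G; apply: le_trans (G _ _).
- rewrite addrAC subrr add0r mulr1 /r mulrAC -/b mulrBr mulr1 mulrBl.
  by rewrite lerD2l lerDr mulr_ge0 ?expR_ge0.
- by move=> u /andP[su _]; apply: dy; exact: le_lt_trans su.
move=> u /andP[su us]; have u0 := le_lt_trans s0 su.
have y0 := averaging_ge ay s0 (ltW su) ys.
apply: (le_trans _ (averaging_deriv_ge k (fun j => cb u i j u0) y0)).
rewrite mulrBr lerB // /b.
have -> : rate * (c0 * w0 * expR (- rate) / rate * y k s) =
    c0 * w0 * (expR (- rate) * y k s).
  by field; rewrite gt_eqF.
have yk : expR (- rate) * y k s <= y k u.
  apply: le_trans (averaging_decay k ay s0 (ltW su) ys).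
  rewrite ler_wpM2r // ler_expR mulNr lerN2 ler_piMr ?(ltW rate0) //.
  by rewrite lerBlDl ltW.
apply: ler_pM => //; first by rewrite mulr_ge0 ?ltW.
- by rewrite mulr_ge0 ?expR_ge0.
- by rewrite ler_pM2l // w0_le.
Qed.

Context (w_connect : forall k i, connect (fun a b => 0 < w b a) k i).

(** Each edge of a path costs a factor [rho] and a unit of time. Paths without repeated nodes are
    padded by waiting to exactly [#|I|] steps, so one time and one factor serve all pairs. *)
Lemma averaging_reach : exists2 kappa : R, 0 < kappa < 1 &
  forall y, averaging w c0 c1 y ->
  forall s : R, 0 <= s -> (forall i, 0 <= y i s) ->
  forall k i, kappa * y k s <= y i (s + #|I|%:R).
Proof.
have [rho /andP[r0 r1] Hrho] := averaging_edge.
(* Without nodes [rho ^+ #|I|] would be [1], so [rho] itself is the witness. *)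
have [I0|N0] := posnP #|I|.
  by exists rho => [|y ay s s0 ys k]; [rewrite r0 r1|case: (fintype0 k)].
exists (rho ^+ #|I|); first by rewrite exprn_gt0 //= exprn_ilt1 ?(ltW r0) -?lt0n.
move=> y ay s s0 ys k i.
pose e a b := (b == a) || (0 < w b a).
have walk p : forall k s, 0 <= s -> (forall i, 0 <= y i s) -> path e k p ->
    rho ^+ size p * y k s <= y (last k p) (s + (size p)%:R).
  elim: p => [|j p IHp] k' s' s'0 ys' /=; first by rewrite mul1r addr0.
  move=> /andP[ekj pjp].
  have s'1 : s' <= s' + 1 by rewrite lerDl.
  have := IHp j _ (le_trans s'0 s'1) (averaging_ge ay s'0 s'1 ys') pjp.
  rewrite -addrA -natr1 [1 + _]addrC; apply: le_trans.
  by rewrite exprSr -mulrA ler_wpM2l ?exprn_ge0 ?(ltW r0)// Hrho.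
have /connectP[p pk ->] := w_connect k i.
have [p' pk' up' _] := shortenP pk.
have sp' : (size p' <= #|I|)%N.
  apply: ltnW; rewrite -[X in (X <= _)%N]/(size (k :: p')).
  by rewrite -(card_uniqP up') max_card.
pose q := p' ++ nseq (#|I| - size p') (last k p').
have sq : size q = #|I| by rewrite size_cat size_nseq subnKC.
have lq : last k q = last k p'.
  by rewrite last_cat; elim: (#|I| - size p')%N => //= m; case: m.
have pq : path e k q.
  rewrite cat_path (sub_path _ pk') /=; last by move=> a b; rewrite /e orbC => ->.
  by elim: (#|I| - size p')%N (last k p') => //= m IHm a; rewrite /e eqxx IHm.
by have := walk q k s s0 ys pq; rewrite sq lq.
Qed.

Lemma averaging_le y (m s t : R) : averaging w c0 c1 y -> 0 <= s -> s <= t ->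
  (forall i, y i s <= m) -> forall i, y i t <= m.
Proof.
move=> ay s0 st ys i.
have := @averaging_ge _ (- m) s t (averaging_affine (-1) 0 ay) s0 st _ i.
by rewrite !addr0 mulN1r lerN2; apply=> j; rewrite addr0 mulN1r lerN2.
Qed.

(** This is [averaging_reach] for the nonnegative systems [y - m] and [m - y]. *)
Lemma averaging_reach_bounds : exists2 kappa : R, 0 < kappa < 1 &
  forall y, averaging w c0 c1 y -> forall s m : R, 0 <= s ->
  ((forall i, m <= y i s) ->
    forall k i, m + kappa * (y k s - m) <= y i (s + #|I|%:R)) /\
  ((forall i, y i s <= m) ->
    forall k i, y i (s + #|I|%:R) <= m - kappa * (m - y k s)).
Proof.
have [kappa k01 H] := averaging_reach.
exists kappa => // y ay s m s0; split=> ys k i.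
  have := H _ (averaging_affine 1 (- m) ay) s s0 _ k i.
  by rewrite !mul1r lerBrDl; apply=> j; rewrite mul1r subr_ge0.
have := H _ (averaging_affine (-1) m ay) s s0 _ k i.
rewrite !mulN1r => h.
suff : forall j, 0 <= -1 * y j s + m by move=> /h; lra.
by move=> j; rewrite mulN1r addrC subr_ge0.
Qed.

(** The ranges of the state are nested and their length decays geometrically. For strictness, a node
    off the bound [m] at time [0] pulls every node off it by time [#|I|], by a definite amount. *)
Lemma averaging_converges y : averaging w c0 c1 y -> I ->
  exists2 ybar : R,
    exists2 C : R, 0 < C & exists2 gamma : R, 0 < gamma &
      forall t i, 0 <= t -> `|y i t - ybar| <= C * expR (- gamma * t) &
    forall m : R,
      ((forall i, m <= y i 0) -> m <= ybar /\
         (forall k, m < y k 0 -> m < ybar)) /\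
      ((forall i, y i 0 <= m) -> ybar <= m /\
         (forall k, y k 0 < m -> ybar < m)).
Proof.
move=> ay i0.
(* The limit is the supremum of the lower bounds valid at some time. Bounds persist, so each of them
   is below every upper bound valid at any time. *)
pose A := [set m | exists2 t, 0 <= t & forall i, m <= y i t].
have A_lub t M : 0 <= t -> (forall i, y i t <= M) -> ubound A M.
  move=> t0 yM m [t' t'0 ym].
  have tt' : 0 <= Num.max t t' by rewrite le_max t0.
  apply: (@le_trans _ _ (y i0 (Num.max t t'))).
    by apply: (averaging_ge ay t'0) ym _; rewrite le_max lexx orbT.
  by apply: (averaging_le ay t0) yM _; rewrite le_max lexx.
pose argmin t := [arg min_(i < i0) y i t]%O.
pose argmax t := [arg max_(i > i0) y i t]%O.
have ymin t i : y (argmin t) t <= y i t.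
  by rewrite /argmin; case: arg_minP => // k _; apply.
have ymax t i : y i t <= y (argmax t) t.
  by rewrite /argmax; case: arg_maxP => // k _; apply.
have A0 : A !=set0 by exists (y (argmin 0) 0); exists 0.
have ge_ybar t M : 0 <= t -> (forall i, y i t <= M) -> sup A <= M.
  by move=> t0 yM; apply: ge_sup => //; exact: A_lub yM.
have le_ybar t m : 0 <= t -> (forall i, m <= y i t) -> m <= sup A.
  move=> t0 ym; apply: ub_le_sup; last by exists t.
  by exists (y (argmax 0) 0); exact: (A_lub 0).
have [kappa /andP[k0 k1] Hk] := averaging_reach_bounds.
have N0 : 0 < #|I|%:R :> R by rewrite ltr0n; apply/card_gt0P; exists i0.
exists (sup A); last first.
  move=> m; have [Hl Hu] := Hk y ay 0 m (lexx _).
  split=> ym; split.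
  - exact: le_ybar ym.
  - move=> k mk; apply: (@lt_le_trans _ _ (m + kappa * (y k 0 - m))).
      by rewrite ltrDl mulr_gt0 // subr_gt0.
    by apply: (le_ybar (0 + #|I|%:R)) => [|i]; [rewrite add0r ltW|exact: Hl].
  - exact: ge_ybar ym.
  - move=> k mk; apply: (@le_lt_trans _ _ (m - kappa * (m - y k 0))).
      by apply: (ge_ybar (0 + #|I|%:R)) => [|i]; [rewrite add0r ltW|exact: Hu].
    by rewrite ltrBlDr ltrDl mulr_gt0 // subr_gt0.
pose q := 1 - kappa.
have q0 : 0 < q by rewrite subr_gt0.
have q1 : q < 1 by rewrite ltrBlDr ltrDl.
pose D t := y (argmax t) t - y (argmin t) t.
have D0 t : 0 <= D t by rewrite subr_ge0.
have Dmono s t : 0 <= s -> s <= t -> D t <= D s.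
  move=> s0 st; rewrite lerB //.
    exact: (averaging_le ay s0 st (ymax s)).
  exact: (averaging_ge ay s0 st (ymin s)).
(* After [#|I|] units of time every node exceeds the old minimum by [kappa * D s], while the maximum
   has not grown. *)
have Dstep s : 0 <= s -> D (s + #|I|%:R) <= q * D s.
  move=> s0; have sN : s <= s + #|I|%:R by rewrite lerDl ltW.
  have [Hl _] := Hk y ay s (y (argmin s) s) s0.
  have := Hl (ymin s) (argmax s) (argmin (s + #|I|%:R)).
  have := averaging_le ay s0 sN (ymax s) (argmax (s + #|I|%:R)).
  rewrite /D /q mulrBl mul1r; lra.
have Dpow n : D (n%:R * #|I|%:R) <= q ^+ n * D 0.
  elim: n => [|n IHn]; first by rewrite mul0r expr0 mul1r.
  rewrite -natr1 mulrDl mul1r; apply: le_trans (Dstep _ _) _.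
    by rewrite mulr_ge0 // ltW.
  by rewrite exprS -mulrA ler_pM2l.
(* Division by [q] makes up for rounding [t / #|I|] down to an integer; the [+ 1] keeps the constant
   positive when the initial spread is zero. *)
exists ((D 0 + 1) / q); first by rewrite divr_gt0 // ltr_wpDl.
exists (- ln q / #|I|%:R).
  by rewrite divr_gt0 // oppr_gt0 ln_lt0 // q0.
move=> t i t0; apply: (@le_trans _ _ (D t)).
  have := le_ybar t _ t0 (ymin t); have := ge_ybar t _ t0 (ymax t).
  have := ymin t i; have := ymax t i.
  by rewrite ler_norml /D; lra.
have /andP[nt tn] := truncn_itv (divr_ge0 t0 (ltW N0)).
set n := Num.truncn _ in nt tn.
apply: (@le_trans _ _ (D (n%:R * #|I|%:R))).
  by apply: Dmono; [rewrite mulr_ge0 // ltW|rewrite -ler_pdivlMr].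
apply: (le_trans (Dpow n)).
have qn : q ^+ n.+1 <= expR (- (- ln q / #|I|%:R) * t).
  rewrite -[in leLHS](lnK q0) -expRM_natl ler_expR.
  have -> : - (- ln q / #|I|%:R) * t = t / #|I|%:R * ln q.
    by field; rewrite gt_eqF.
  by rewrite ler_wnM2r ?ltW // ln_lt0 // q0.
have -> : q ^+ n * D 0 = D 0 / q * q ^+ n.+1.
  by rewrite exprS; field; rewrite gt_eqF.
apply: ler_pM => //; [by rewrite divr_ge0 // ltW|by rewrite exprn_ge0 // ltW|].
by rewrite ler_pM2r ?invr_gt0 // lerDl.
Qed.

End Averaging.

(** * Slopes of secants *)

(* [d] stands for the slope of the degenerate secant [a = b]. *)
Definition secant (R : realType) (f : R -> R) (d a b : R) : R :=
  if b == a then d else (f b - f a) / (b - a).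

Lemma secantE (R : realType) (f : R -> R) (d a b : R) :
  f b - f a = secant f d a b * (b - a).
Proof.
rewrite /secant; have [->|ba] := eqVneq b a; first by rewrite !subrr mulr0.
by rewrite divfK // subr_eq0.
Qed.

(** By the mean value theorem a nondegenerate slope is a value of [df]; the bounds on [d] cover the
    degenerate one. *)
Lemma secant_bounds (R : realType) (f df : R -> R) (m M l u d : R) :
  (forall x, m <= x <= M -> is_derive x 1 f (df x)) ->
  (forall x, m <= x <= M -> l <= df x <= u) -> l <= d <= u ->
  forall a b, m <= a <= M -> m <= b <= M -> l <= secant f d a b <= u.
Proof.
move=> ddf dfb db.
suff H a b : a < b -> m <= a -> b <= M -> l <= (f b - f a) / (b - a) <= u.
  move=> a b /andP[ma aM] /andP[mb bM]; rewrite /secant.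
  have [ba|ab|//] := ltgtP b a; last exact: H.
  by rewrite -[X in X / _]opprB -[X in _ / X]opprB invrN mulrNN; exact: H.
move=> ab ma bM.
have inmM x : a <= x <= b -> m <= x <= M.
  by move=> /andP[ax xb]; rewrite (le_trans ma ax) (le_trans xb bM).
have dab x : x \in `]a, b[ -> is_derive x 1 f (df x).
  by rewrite in_itv /= => /andP[ax xb]; apply/ddf/inmM; rewrite !ltW.
have cab : {within `[a, b], continuous f}.
  apply: derivable_within_continuous => x; rewrite in_itv /= => xab.
  by have [] := ddf x (inmM x xab).
have [x xab ->] := MVT ab dab cab.
rewrite mulfK; last by rewrite subr_eq0 gt_eqF.
by apply/dfb/inmM; move: xab; rewrite in_itv /= => /andP[? ?]; rewrite !ltW.
Qed.

(** * Extreme coordinates and the Euclidean norm *)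

Section Bounds.
Context (R : realType) (n : nat).
Implicit Types (v : 'rV[R]_n.+1).

Lemma vmin_le v i : vmin v <= v 0 i.
Proof. exact: bigmin_le. Qed.

Lemma vmax_ge v i : v 0 i <= vmax v.
Proof. exact: (le_bigmax _ (fun i => v 0 i)). Qed.

Lemma vmin_gt v (m : R) : (forall i, m < v 0 i) -> m < vmin v.
Proof. by move=> mv; apply: lt_bigmin. Qed.

Lemma not_consensus_vmin v : ~ consensus v -> exists k, vmin v < v 0 k.
Proof.
move=> nc; apply: contrapT => /forallNP H; apply: nc; exists (vmin v).
apply/rowP => i; rewrite mxE; apply/eqP; rewrite eq_le vmin_le andbT leNgt.
exact/negP.
Qed.

Lemma not_consensus_vmax v : ~ consensus v -> exists k, v 0 k < vmax v.
Proof.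
move=> nc; apply: contrapT => /forallNP H; apply: nc; exists (vmax v).
apply/rowP => i; rewrite mxE; apply/eqP; rewrite eq_le vmax_ge /= leNgt.
exact/negP.
Qed.

Lemma eucl_norm_le v (d : R) : (forall i, `|v 0 i| <= d) ->
  eucl_norm v <= n.+1%:R * d.
Proof.
move=> vd; have d0 : 0 <= d by apply: le_trans (vd ord0).
have nd0 : 0 <= n.+1%:R * d by rewrite mulr_ge0.
rewrite -(ger0_norm nd0) -sqrtr_sqr ler_wsqrtr //.
apply: (@le_trans _ _ (\sum_(i < n.+1) d ^+ 2)).
  apply: ler_sum => i _; rewrite -real_normK ?num_real //.
  by rewrite lerXn2r ?nnegrE.
rewrite sumr_const card_ord exprMn -[leLHS]mulr_natl ler_wpM2r ?exprn_ge0 //.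
by rewrite expr2 ler_peMr // ler1n.
Qed.

End Bounds.

(** * Protocols driven by differences of logarithms *)

Section LogDiffusive.
Context (R : realType) (n : nat) (G : wdigraph R n.+1).
Implicit Types (x : 'rV[R]_n.+1) (i j : 'I_n.+1).

Let w := weight G.

Lemma weight_ge0 i j : 0 <= w i j.
Proof.
rewrite /w; case: (boolP ((j, i) \in branch G)) => [/weight_gt0/ltW //|].
by move=> /weight_eq0 ->.
Qed.

Lemma sum_in_nbhd i (f : 'I_n.+1 -> R) :
  \sum_(j in in_nbhd G i) w i j * f j = \sum_j w i j * f j.
Proof.
rewrite big_mkcond; apply: eq_bigr => j _; rewrite inE.
by case: ifPn => // /weight_eq0; rewrite /w => ->; rewrite mul0r.
Qed.

(** The box comes before [h0] and [h1], since on the whole positive orthant the factor [h] need not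
    be bounded, nor bounded away from [0]. *)
Definition log_diffusive (F : 'rV[R]_n.+1 -> 'I_n.+1 -> R) :=
  forall m M : R, 0 < m -> m <= M ->
  exists h : 'rV[R]_n.+1 -> 'I_n.+1 -> R, exists h0 h1 : R,
    [/\ 0 < h0, 0 <= h1 &
      forall x, (forall i, m <= x 0 i <= M) -> forall i,
      h0 <= h x i <= h1 /\
      F x i = h x i * \sum_j w i j * (ln (x 0 j) - ln (x 0 i))].

Lemma log_diffusive_argmin F x i : log_diffusive F ->
  0 < x 0 i -> (forall j, x 0 i <= x 0 j) -> 0 <= F x i.
Proof.
move=> FP xi0 xmin.
have [h [h0 [h1 [h00 _ H]]]] := FP (x 0 i) (vmax x) xi0 (vmax_ge x i).
have [|/andP[hx _] ->] := H x _ i; first by move=> j; rewrite xmin vmax_ge.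
apply: mulr_ge0; [exact: le_trans (ltW h00) hx|apply: sumr_ge0 => j _].
by rewrite mulr_ge0 ?weight_ge0 // subr_ge0 ler_ln ?posrE // (lt_le_trans xi0).
Qed.

Lemma log_diffusive_argmax F x i : log_diffusive F ->
  (forall j, 0 < x 0 j) -> (forall j, x 0 j <= x 0 i) -> F x i <= 0.
Proof.
move=> FP x0 xmax.
have [h [h0 [h1 [h00 _ H]]]] := FP (vmin x) (x 0 i) (vmin_gt x0) (vmin_le x i).
have [|/andP[hx _] ->] := H x _ i; first by move=> j; rewrite xmax vmin_le.
apply: mulr_ge0_le0; [exact: le_trans (ltW h00) hx|apply: sumr_le0 => j _].
by rewrite mulr_ge0_le0 ?weight_ge0 // subr_le0 ler_ln ?posrE.
Qed.

(** Positivity for [t > 0] is not assumed: [min_barrier] at level [0] asks for the sign condition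
    only where the minimum is positive. *)
Lemma solution_vmin F (x : R -> 'rV[R]_n.+1) : log_diffusive F ->
  solution_from_positive F x -> forall t i, 0 <= t -> vmin (x 0) <= x t 0 i.
Proof.
move=> FP [x0 cx dx] t i t0.
apply: (@min_barrier R _ (fun i t => x t 0 i) (fun i t => F (x t) i) 0 t 0) => //.
- exact: vmin_gt.
- move=> j; apply: continuous_subspaceW (cx j) => u /=.
  by rewrite !in_itv /= => /andP[->].
- by move=> u j u0 _; exact: dx.
- by move=> u j _ _; exact: log_diffusive_argmin.
- by move=> j; exact: vmin_le.
Qed.

(** The barrier is applied to [- x]. Positivity of the state comes from [solution_vmin], so any
    level below [- vmax (x 0)] would do. *)
Lemma solution_vmax F (x : R -> 'rV[R]_n.+1) : log_diffusive F ->
  solution_from_positive F x -> forall t i, 0 <= t -> x t 0 i <= vmax (x 0).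
Proof.
move=> FP xF t i t0; have [x0 cx dx] := xF; rewrite -lerN2.
apply: (@min_barrier R _ (fun i t => - x t 0 i) (fun i t => - F (x t) i) 0 t
  (- vmax (x 0) - 1)) => //.
- by rewrite gtrBl.
- move=> j u; apply: cvgN; apply: (continuous_subspaceW _ (cx j)) => {}u /=.
  by rewrite !in_itv /= => /andP[->].
- by move=> u j u0 _; apply: is_deriveN; exact: dx.
- move=> u j u0 _ _ umax; rewrite oppr_ge0.
  apply: log_diffusive_argmax => // k; last by rewrite -lerN2.
  exact: lt_le_trans (vmin_gt x0) (solution_vmin FP xF k (ltW u0)).
- by move=> j; rewrite lerN2 vmax_ge.
Qed.

Lemma solution_averaging F (x : R -> 'rV[R]_n.+1) : log_diffusive F ->
  solution_from_positive F x ->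
  exists c0 c1 : R, [/\ 0 < c0, 0 <= c1 &
    averaging w c0 c1 (fun i t => x t 0 i)].
Proof.
move=> FP xF; have [x0 cx dx] := xF.
pose m := vmin (x 0); pose M := vmax (x 0).
have m0 : 0 < m by exact: vmin_gt.
have mM : m <= M by apply: (le_trans (vmin_le _ ord0)); exact: vmax_ge.
have M0 : 0 < M by exact: lt_le_trans mM.
have xb t i : 0 <= t -> m <= x t 0 i <= M.
  by move=> t0; rewrite (solution_vmin FP xF) // (solution_vmax FP xF).
have [h [h0 [h1 [h00 h10 H]]]] := FP m M m0 mM.
(* For equal arguments any slope between [M^-1] and [m^-1], the bounds for the derivative of [ln] on
   [[m, M]], would serve. *)
pose s a b := secant (@ln R) M^-1 a b.
have sb a b : m <= a <= M -> m <= b <= M -> M^-1 <= s a b <= m^-1.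
  apply: (@secant_bounds _ _ (fun u => u^-1)).
  - by move=> u /andP[mu _]; apply: is_derive1_ln; exact: lt_le_trans mu.
  - move=> u /andP[mu uM]; have u0 := lt_le_trans m0 mu.
    by rewrite !lef_pV2 ?posrE // mu uM.
  - by rewrite lexx lef_pV2 ?posrE.
exists (h0 * M^-1), (h1 * m^-1); split.
- by rewrite mulr_gt0 ?invr_gt0.
- by rewrite mulr_ge0 ?invr_ge0 // ltW.
split=> //.
exists (fun t i j => h (x t) i * w i j * s (x t 0 i) (x t 0 j)); split.
  move=> t i j /ltW t0.
  have [/andP[h0x hxh1] _] := H (x t) (fun k => xb t k t0) i.
  have /andP[sl su] := sb _ _ (xb t i t0) (xb t j t0).
  have hx0 := le_trans (ltW h00) h0x.
  have m'0 : 0 <= M^-1 by rewrite invr_ge0 ltW.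
  have s0 := le_trans m'0 sl.
  rewrite [h (x t) i * _ * _]mulrAC.
  apply/andP; split; apply: ler_wpM2r; rewrite ?weight_ge0 // ler_pM //.
  exact: ltW.
move=> t i t0; apply: (is_derive_eq (dx t i t0)).
have [_ ->] := H (x t) (fun k => xb t k (ltW t0)) i.
rewrite mulr_sumr; apply: eq_bigr => j _.
by rewrite (secantE _ M^-1) -/(s _ _) !mulrA.
Qed.

Lemma log_diffusive_reaches_consensus F (x : R -> 'rV[R]_n.+1) :
  strongly_connected G -> log_diffusive F -> solution_from_positive F x ->
  reaches_consensus x.
Proof.
move=> hG FP xF.
have [c0 [c1 [c00 c10 ax]]] := solution_averaging FP xF.
(* The indices swap because [w] takes the head of a branch first. *)
have w_conn k i : connect (fun a b => 0 < w b a) k i.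
  apply: connect_sub (hG k i) => a b ab; apply: connect1; exact: weight_gt0.
have [xbar [C C0 [gamma gamma0 xconv]] xbarP] :=
  averaging_converges weight_ge0 c00 c10 w_conn ax ord0.
exists xbar; split.
- exists (n.+1%:R * C), gamma; split=> //; first by rewrite mulr_gt0.
  move=> t t0; rewrite -mulrA; apply: eucl_norm_le => i.
  by rewrite !mxE; exact: xconv.
- have [+ _] := xbarP (vmin (x 0)); have [_ +] := xbarP (vmax (x 0)).
  by move=> /(_ (vmax_ge (x 0)))[-> _] /(_ (vmin_le (x 0)))[-> _].
move=> nc.
have [k kmin] := not_consensus_vmin nc; have [k' kmax] := not_consensus_vmax nc.
have [+ _] := xbarP (vmin (x 0)); have [_ +] := xbarP (vmax (x 0)).
move=> /(_ (vmax_ge (x 0)))[_ /(_ k' kmax) ->].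
by move=> /(_ (vmin_le (x 0)))[_ /(_ k kmin) ->].
Qed.

(** * The three protocols *)

Lemma scaling_invariant_log_diffusive :
  log_diffusive (scaling_invariant_protocol G).
Proof.
move=> m M m0 mM; exists (fun _ _ => 1), 1, 1; split=> // x _ i.
rewrite lexx mul1r; split=> //.
exact: (sum_in_nbhd i (fun j => ln (x 0 j) - ln (x 0 i))).
Qed.

Lemma entropic_log_diffusive : log_diffusive (entropic_protocol G).
Proof.
move=> m M m0 mM; exists (fun x i => x 0 i), m, M; split=> //.
  by rewrite (le_trans (ltW m0)).
move=> x xb i; split; first exact: xb.
have x0 j : 0 < x 0 j by have /andP[+ _] := xb j; exact: lt_le_trans.
rewrite -sum_in_nbhd mulr_sumr /entropic_protocol -sumrN; apply: eq_bigr => j _.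
by rewrite ln_div ?posrE // /w; ring.
Qed.

Lemma polynomial_log_diffusive : balanced G ->
  log_diffusive (polynomial_protocol G).
Proof.
move=> bal m M m0 mM.
(* [A] bounds the absolute values of both exponents [u x i] and [v x i] on the box. *)
pose A := (\sum_i \sum_j w i j) * (`|ln m| + `|ln M|).
pose u x i := \sum_j w i j * ln (x 0 j).
pose v x i := \sum_j w i j * ln (x 0 i).
exists (fun x i => secant (@expR R) 1 (v x i) (u x i)), (expR (- A)), (expR A).
split; rewrite ?expR_gt0 ?expR_ge0 // => x xb i.
have x0 j : 0 < x 0 j by have /andP[+ _] := xb j; exact: lt_le_trans.
have lnb j : `|ln (x 0 j)| <= `|ln m| + `|ln M|.
  have /andP[mx xM] := xb j.
  have : ln m <= ln (x 0 j) by rewrite ler_ln ?posrE.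
  have : ln (x 0 j) <= ln M by rewrite ler_ln ?posrE // (lt_le_trans m0).
  have := ler_norm (ln M); have := ler_norm (- ln m); rewrite normrN.
  have := normr_ge0 (ln M); have := normr_ge0 (ln m).
  by rewrite ler_norml; lra.
(* Taking [f] to be the identity gives [u x i]; the constant [i] gives [v x i]. *)
have avgb (f : 'I_n.+1 -> 'I_n.+1) : - A <= \sum_j w i j * ln (x 0 (f j)) <= A.
  rewrite -ler_norml; apply: (le_trans (ler_norm_sum _ _ _)).
  apply: (@le_trans _ _ (\sum_j w i j * (`|ln m| + `|ln M|))).
    apply: ler_sum => j _; rewrite normrM ger0_norm ?weight_ge0 //.
    by rewrite ler_wpM2l ?weight_ge0.
  rewrite -mulr_suml ler_wpM2r ?addr_ge0 //.
  rewrite [leRHS](bigD1 i) //= lerDl sumr_ge0 // => k _.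
  by rewrite sumr_ge0 // => j _; exact: weight_ge0.
split.
  apply: (@secant_bounds _ _ (@expR R) (- A) A) => //.
  - by move=> z /andP[zl zu]; rewrite !ler_expR zl zu.
  (* The degenerate slope [1] is [expR 0], within the bounds because [0 <= A]. *)
  - have A0 : 0 <= A by have := avgb id; rewrite -ler_norml; exact: le_trans.
    by rewrite -expR0 !ler_expR oppr_le0 A0.
  - exact: (avgb (fun=> i)).
  - exact: (avgb id).
have -> : \sum_j w i j * (ln (x 0 j) - ln (x 0 i)) = u x i - v x i.
  by rewrite -sumrB; apply: eq_bigr => j _; rewrite mulrBr.
rewrite -secantE /polynomial_protocol addrC; congr (_ - _).
  rewrite /u -(sum_in_nbhd i (fun j => ln (x 0 j))) expR_sum.
  by apply: eq_bigr => j _; rewrite /powR gt_eqF.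
(* Balance replaces the in-weights of [i] by its out-weights; nodes outside the out-neighborhood
   contribute the factor [expR 0]. *)
rewrite /v -mulr_suml /w bal mulr_suml expR_sum [RHS]big_mkcond /=.
rewrite big_mkcond /=; apply: eq_bigr => j _; rewrite inE /powR gt_eqF //.
by case: ifPn => // /weight_eq0 ->; rewrite mul0r expR0.
Qed.

End LogDiffusive.

Theorem theorem1 (R : realType) (n : nat) (G : wdigraph R n.+1)
    (hG : strongly_connected G) :
  [/\ forall x : R -> 'rV[R]_n.+1,
        solution_from_positive (entropic_protocol G) x -> reaches_consensus x,
      forall x : R -> 'rV[R]_n.+1,
        solution_from_positive (scaling_invariant_protocol G) x ->
        reaches_consensus x &
      balanced G ->
      forall x : R -> 'rV[R]_n.+1,
        solution_from_positive (polynomial_protocol G) x ->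
        reaches_consensus x].
Proof.
split=> [x|x|bal x]; apply: log_diffusive_reaches_consensus => //.
- exact: entropic_log_diffusive.
- exact: scaling_invariant_log_diffusive.
- exact: polynomial_log_diffusive.
Qed.
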